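(* $$M = \sum_{n=1}^{\infty}\frac{I_n}{n} = \log 6.$$
   Context: For $n\ge 0$, $I_n := \frac{1}{2\pi}\int_0^{2\pi}\left(\frac{2+\sin\theta}{3}\right)^{n}d\theta$, and $M:=\sum_{n=1}^{\infty} I_n/n$. Here $\log$ is the natural logarithm. *)

(* Defs.v *)
From Stdlib Require Import Reals.
From Coquelicot Require Import Coquelicot.
Open Scope R_scope.

Definition I_ (n : nat) : R :=
  / (2 * PI) * RInt (fun theta : R => ((2 + sin theta) / 3) ^ n) 0 (2 * PI).

(* [Series] sums from index 0, so the k-th term here is the one for n = k + 1. *)
Definition M_term (k : nat) : R := I_ (S k) / INR (S k).

Definition M : R := Series M_term.

(* Main.v *)
Require Import Defs.
From Stdlib Require Import Reals Lra.
From Coquelicot Require Import Coquelicot.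
Open Scope R_scope.

(** Formally the sum is the mean over a period of
      - ln (1 - (2 + sin t) / 3) = ln 3 - ln (1 - sin t),
    and the mean of ln (1 - sin t) is - ln 2, which gives ln 6. This integrand
    is singular at t = PI / 2, so the sum is regularised by a factor r ^ n with
    r < 1, and r is sent to 1 at the end.

    For r < 1 the geometric series may be integrated term by term
    ([is_series_RInt_geom]), and the mean of 1 / (a - b sin t) is
    1 / sqrt (a ^ 2 - b ^ 2) ([RInt_inv_sub_sin]). With a = 1 - 2 r / 3 and
    b = r / 3 this gives the generating function ([is_pseries_I])
      sum_n I_n r ^ n = 1 / s,   s = sqrt ((1 - r) (1 - r / 3)).
    Hence G(r) = sum_(n >= 1) I_n r ^ n / n has derivative (1 / s - 1) / r,
    which is also the derivative of
      - ln ((1 - 2 r / 3 + s) / 2),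
    the regularised mean of the logarithm. Both functions vanish at 0, so they
    agree on [0, 1) ([PSeries_Int_I]). The closed form is continuous up to
    r = 1, where it equals - ln (1 / 6), and since the I_n are nonnegative this
    left limit forces both the convergence at r = 1 and the value of the sum
    ([is_series_of_left_limit]). *)

(** * Term-by-term integration of a geometric series *)

(** The partial sums of the geometric series of ratio r x(t) miss the limit by
    at most r ^ (N + 1) / (1 - r), uniformly in t. *)
Lemma is_series_RInt_geom (x : R -> R) (a b r : R) :
  a <= b -> 0 <= r < 1 -> (forall t, continuous x t) ->
  (forall t, Rabs (x t) <= 1) ->
  is_series (fun n => r ^ n * RInt (fun t => x t ^ n) a b)
            (RInt (fun t => / (1 - r * x t)) a b).
Proof.
intros Hab Hr Cx Bx.
assert (Hpos : forall t, 1 - r <= 1 - r * x t).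
{ intros t. assert (H := Bx t). apply Rabs_le_between in H. nra. }
assert (Cpow : forall n t, continuous (fun t => x t ^ n) t).
{ intros n; induction n as [|n IH]; intros t; simpl.
  - apply continuous_const.
  - apply (continuous_mult x (fun t => x t ^ n)); [apply Cx | apply IH]. }
set (g := fun t => / (1 - r * x t)).
assert (Ig : is_RInt g a b (RInt g a b)).
{ apply (RInt_correct (V := R_CompleteNormedModule)).
  apply (ex_RInt_continuous (V := R_CompleteNormedModule)). intros t _.
  apply continuous_comp with (g := Rinv).
  - apply (continuous_minus (fun _ => 1) (fun t => r * x t)).
    + apply continuous_const.
    + apply (continuous_scal_r r x), Cx.
  - apply continuous_Rinv. specialize (Hpos t). lra. }
assert (Is : forall N, is_RInt (fun t => sum_f_R0 (fun n => (r * x t) ^ n) N) a b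
               (sum_n (fun n => r ^ n * RInt (fun t => x t ^ n) a b) N)).
{ assert (It : forall n, is_RInt (fun t => (r * x t) ^ n) a b
                   (r ^ n * RInt (fun t => x t ^ n) a b)).
  { intros n. apply (is_RInt_ext (fun t => r ^ n * x t ^ n)).
    - intros t _. symmetry. apply Rpow_mult_distr.
    - apply (is_RInt_scal (fun t => x t ^ n)).
      apply (RInt_correct (V := R_CompleteNormedModule)).
      apply (ex_RInt_continuous (V := R_CompleteNormedModule)).
      intros t _. apply Cpow. }
  intros N; induction N as [|N IH].
  - rewrite sum_O. apply It.
  - rewrite sum_Sn. simpl sum_f_R0. apply (is_RInt_plus _ _ _ _ _ _ IH (It (S N))). }
set (u := sum_n _) in *.
assert (Herr : forall N, Rabs (u N - RInt g a b) <= (b - a) * (r ^ S N / (1 - r))).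
{ intros N.
  refine (norm_RInt_le_const _ a b _ _ Hab _ (is_RInt_minus _ _ _ _ _ _ (Is N) Ig)).
  intros t _. specialize (Hpos t).
  rewrite tech3 by lra. unfold g.
  change (Rabs ((1 - (r * x t) ^ S N) / (1 - r * x t) - / (1 - r * x t))
          <= r ^ S N / (1 - r)).
  replace ((1 - (r * x t) ^ S N) / (1 - r * x t) - / (1 - r * x t))
    with (- ((r * x t) ^ S N * / (1 - r * x t))) by (field; lra).
  rewrite Rabs_Ropp, Rabs_mult, <- RPow_abs, Rabs_mult.
  rewrite (Rabs_pos_eq r), (Rabs_pos_eq (/ _)).
  2: left; apply Rinv_0_lt_compat; lra.
  2: lra.
  apply Rmult_le_compat.
  - apply pow_le, Rmult_le_pos; [lra | apply Rabs_pos].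
  - left; apply Rinv_0_lt_compat; lra.
  - apply pow_incr. split.
    + apply Rmult_le_pos; [lra | apply Rabs_pos].
    + specialize (Bx t). nra.
  - apply Rinv_le_contravar; lra. }
change (is_lim_seq u (RInt g a b)).
apply (is_lim_seq_ext (fun N => (u N - RInt g a b) + RInt g a b)).
{ intros N; ring. }
replace (Finite (RInt g a b)) with (Finite (0 + RInt g a b)) by (f_equal; ring).
apply is_lim_seq_plus'; [| apply is_lim_seq_const].
apply is_lim_seq_abs_0.
apply is_lim_seq_le_le with (u := fun _ => 0)
  (w := fun N => (b - a) * / (1 - r) * r ^ S N).
- intros N; split; [apply Rabs_pos |].
  eapply Rle_trans; [apply Herr | right; unfold Rdiv; ring].
- apply is_lim_seq_const.
- replace (Finite 0) with (Rbar_mult ((b - a) * / (1 - r)) 0)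
    by (simpl; f_equal; ring).
  apply is_lim_seq_scal_l, (is_lim_seq_incr_1 (fun N => r ^ N)), is_lim_seq_geom.
  rewrite Rabs_pos_eq; lra.
Qed.

(** * The mean of 1 / (a - b sin t) *)

Lemma sub_sin_pos (a b t : R) : Rabs b < a -> 0 < a - b * sin t.
Proof.
intros Hab. apply Rabs_lt_between in Hab. assert (H := SIN_bound t).
destruct (Rle_dec 0 b); nra.
Qed.

(** The textbook primitive, through tan (t / 2), jumps inside the period. This
    one is smooth on the whole line: with q = b / (a + s), the function
    s / (a - b sin t) is the Poisson kernel
    (1 - q ^ 2) / (1 - 2 q sin t + q ^ 2), and t minus twice the arctangent is
    the integral of that kernel. *)
Lemma is_derive_inv_sub_sin (a b t : R) :
  Rabs b < a ->
  let s := sqrt (a ^ 2 - b ^ 2) in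
  is_derive (fun t => (t - 2 * atan (b * cos t / (a + s - b * sin t))) / s) t
            (/ (a - b * sin t)).
Proof.
intros Hab s.
assert (Hb := sub_sin_pos a b t Hab).
apply Rabs_lt_between in Hab.
assert (Hs : 0 < s) by (apply sqrt_lt_R0; nra).
assert (Es : s ^ 2 = a ^ 2 - b ^ 2) by (apply pow2_sqrt; nra).
assert (Hc := sin2_cos2 t). unfold Rsqr in Hc.
auto_derive; [lra |].
set (S := sin t) in *. set (C := cos t) in *.
change (a + s + - (b * S)) with (a + s - b * S).
set (d := a + s - b * S).
assert (Hd : 0 < d) by (unfold d; lra).
assert (Ec : b * C * (b * C) = (a + s) * (a - s) - b * S * (b * S)).
{ transitivity (b ^ 2 * (1 - S * S)).
  - rewrite <- Hc; ring.
  - replace (b ^ 2) with (a ^ 2 - s ^ 2) at 1 by lra.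
    transitivity (a ^ 2 - s ^ 2 - b ^ 2 * (S * S)); [| ring].
    rewrite Es; ring. }
assert (Hden : 1 + b * C * / d * (b * C * / d * 1)
               = 2 * (a + s) * (a - b * S) / (d * d)).
{ replace (1 + _) with ((d * d + b * C * (b * C)) / (d * d)) by (field; lra).
  f_equal. rewrite Ec. unfold d; ring. }
assert (Hnum : b * (1 * - S) * / d + b * C * (- - (b * (1 * C)) * / (d * d))
               = (a + s) * (a - s - b * S) / (d * d)).
{ replace (_ + _) with ((b * C * (b * C) - b * S * d) / (d * d)) by (field; lra).
  f_equal. rewrite Ec. unfold d; ring. }
rewrite Hden, Hnum.
field. repeat split; lra.
Qed.

(** The arctangent term is periodic, so only t / s contributes. *)
Lemma RInt_inv_sub_sin (a b : R) :
  Rabs b < a ->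
  RInt (fun t => / (a - b * sin t)) 0 (2 * PI) = 2 * PI / sqrt (a ^ 2 - b ^ 2).
Proof.
intros Hab.
assert (Hs : 0 < sqrt (a ^ 2 - b ^ 2)).
{ apply Rabs_lt_between in Hab. apply sqrt_lt_R0; nra. }
apply is_RInt_unique.
evar_last.
{ apply is_RInt_derive; intros t _.
  - apply is_derive_inv_sub_sin, Hab.
  - apply (ex_derive_continuous (fun t => / (a - b * sin t))).
    auto_derive. assert (H := sub_sin_pos a b t Hab). lra. }
change minus with Rminus. cbv beta.
rewrite sin_2PI, cos_2PI, sin_0, cos_0. unfold Rdiv. ring.
Qed.

(** * Passing to the boundary of the disc of convergence *)

Lemma at_left_1_unit_interval : at_left 1 (fun r => 0 < r < 1).
Proof.
exists (mkposreal 1 Rlt_0_1). intros r Hr Hr1. simpl in Hr.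
apply Rabs_lt_between in Hr. unfold minus, plus, opp in Hr; simpl in Hr. lra.
Qed.

(** For nonnegative coefficients Abel's theorem has a converse, which delivers
    convergence at 1 and not only the value. Each partial sum at r < 1 lies
    below the whole power series, so letting r tend to 1 bounds all partial
    sums at 1 by l; conversely the series at 1 dominates the power series at
    every r < 1, so its sum is at least l. *)
Lemma is_series_of_left_limit (a : nat -> R) (l : R) :
  (forall n, 0 <= a n) ->
  (forall r, 0 < r < 1 -> ex_pseries a r) ->
  filterlim (PSeries a) (at_left 1) (locally l) ->
  is_series a l.
Proof.
intros Ha Hex Hl.
assert (Hnear := at_left_1_unit_interval).
assert (Hterm : forall r n, 0 < r < 1 -> 0 <= a n * r ^ n <= a n).
{ intros r n Hr. assert (0 <= r ^ n) by (apply pow_le; lra).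
  assert (r ^ n <= 1) by (rewrite <- (pow1 n); apply pow_incr; lra).
  specialize (Ha n). nra. }
assert (Hincr : forall N, sum_n a N <= sum_n a (S N)).
{ intros N. rewrite sum_Sn. unfold plus; simpl. specialize (Ha (S N)). lra. }
assert (Hsum : forall N, sum_n a N <= l).
{ intros N.
  apply (filterlim_le (F := at_left 1) (fun r => sum_f_R0 (fun n => a n * r ^ n) N)
           (PSeries a) (sum_n a N) l); [| | exact Hl].
  - revert Hnear. apply filter_imp. intros r Hr.
    apply (is_lim_seq_incr_compare (fun N => sum_f_R0 (fun n => a n * r ^ n) N)).
    + apply (is_lim_seq_ext (sum_n (fun n => a n * r ^ n))).
      { intros m. apply sum_n_Reals. }
      apply Series_correct, ex_pseries_R, Hex, Hr.
    + intros m. simpl sum_f_R0. specialize (Hterm r (S m) Hr). simpl in Hterm |- *. lra.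
  - apply (filterlim_filter_le_1 (F := locally 1) (G := at_left 1)).
    { apply filter_le_within. }
    rewrite sum_n_Reals.
    replace (sum_f_R0 a N) with (sum_f_R0 (fun n => a n * 1 ^ n) N).
    2: { apply sum_eq. intros n _. rewrite pow1; ring. }
    apply (continuity_pt_filterlim (fun r => sum_f_R0 (fun n => a n * r ^ n) N)).
    apply continuity_finite_sum. }
assert (Hexs : ex_series a).
{ apply (ex_finite_lim_seq_incr _ l Hincr Hsum). }
replace l with (Series a); [apply Series_correct, Hexs |].
apply Rle_antisym.
- apply (is_lim_seq_le (sum_n a) (fun _ => l) (Series a) l Hsum).
  + apply Series_correct, Hexs.
  + apply is_lim_seq_const.
- apply (filterlim_le (F := at_left 1) (PSeries a) (fun _ => Series a) l (Series a)).
  + revert Hnear. apply filter_imp. intros r Hr.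
    apply Series_le; [intros n; apply Hterm, Hr | exact Hexs].
  + exact Hl.
  + apply filterlim_const.
Qed.

(** * The generating function of the moments *)

Lemma I_bounds (n : nat) : 0 <= I_ n <= 1.
Proof.
assert (HPI := PI_RGT_0).
assert (Hx : forall t, 0 <= (2 + sin t) / 3 <= 1).
{ intros t. assert (H := SIN_bound t). lra. }
assert (Hex : ex_RInt (fun t => ((2 + sin t) / 3) ^ n) 0 (2 * PI)).
{ apply (ex_RInt_continuous (V := R_CompleteNormedModule)). intros t _.
  apply (ex_derive_continuous (fun t => ((2 + sin t) / 3) ^ n)). auto_derive. easy. }
assert (H0 : 0 <= RInt (fun t => ((2 + sin t) / 3) ^ n) 0 (2 * PI)).
{ apply RInt_ge_0; [lra | exact Hex |]. intros t _. apply pow_le, Hx. }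
assert (H1 : RInt (fun t => ((2 + sin t) / 3) ^ n) 0 (2 * PI) <= 2 * PI).
{ replace (2 * PI) with (RInt (fun _ => 1) 0 (2 * PI)) at 2.
  2: { rewrite RInt_const. unfold scal; simpl; unfold mult; simpl. ring. }
  apply RInt_le; [lra | exact Hex | apply ex_RInt_const |].
  intros t _. rewrite <- (pow1 n). apply pow_incr, Hx. }
unfold I_. split.
- apply Rmult_le_pos; [left; apply Rinv_0_lt_compat; lra | exact H0].
- apply (Rmult_le_reg_l (2 * PI)); [lra |].
  rewrite <- Rmult_assoc, Rinv_r by lra. lra.
Qed.

Lemma is_pseries_I (r : R) :
  0 <= r < 1 -> is_pseries I_ r (/ sqrt ((1 - r) * (1 - r / 3))).
Proof.
intros Hr. assert (HPI := PI_RGT_0).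
assert (Hs : 0 < sqrt ((1 - r) * (1 - r / 3))) by (apply sqrt_lt_R0; nra).
assert (HS := is_series_RInt_geom (fun t => (2 + sin t) / 3) 0 (2 * PI) r).
apply (is_series_scal (/ (2 * PI))) in HS; cycle 1.
- lra.
- exact Hr.
- intros t. apply (ex_derive_continuous (fun t => (2 + sin t) / 3)).
  auto_derive. easy.
- intros t. assert (H := SIN_bound t). apply Rabs_le. lra.
- rewrite (RInt_ext _ (fun t => / ((1 - 2 * r / 3) - r / 3 * sin t))) in HS.
  2: { intros t _. f_equal. field. }
  rewrite RInt_inv_sub_sin in HS by (rewrite Rabs_pos_eq; lra).
  replace ((1 - 2 * r / 3) ^ 2 - (r / 3) ^ 2) with ((1 - r) * (1 - r / 3)) in HS by field.
  replace (/ sqrt _) with (scal (/ (2 * PI)) (2 * PI / sqrt ((1 - r) * (1 - r / 3)))).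
  2: { unfold scal; simpl; unfold mult; simpl. field. lra. }
  apply is_pseries_R. revert HS. apply is_series_ext. intros n.
  unfold scal; simpl; unfold mult; simpl. unfold I_. ring.
Qed.

(** * The logarithmic generating function *)

(** The mean over a period of - ln (1 - r (2 + sin t) / 3). *)
Definition mean_log (r : R) : R :=
  - ln ((1 - 2 * r / 3 + sqrt ((1 - r) * (1 - r / 3))) / 2).

Lemma is_derive_mean_log (r : R) :
  0 < r < 1 ->
  is_derive mean_log r ((/ sqrt ((1 - r) * (1 - r / 3)) - 1) / r).
Proof.
intros Hr. unfold mean_log.
assert (Hq : 0 < (1 - r) * (1 - r / 3)) by nra.
assert (Hs := sqrt_lt_R0 _ Hq). assert (Es := sqrt_sqrt _ (Rlt_le _ _ Hq)).
auto_derive; change ((1 + - r) * (1 + - (r * / 3))) with ((1 - r) * (1 - r / 3)).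
{ repeat split; lra. }
set (s := sqrt _) in *.
(* Clearing denominators leaves an identity that holds modulo the equation
   for s * s only, so that equation is applied here, before field. *)
assert (E : r * (2 * s + 2 - r) = 3 * (1 - s) * (1 - 2 * r / 3 + s)).
{ transitivity (3 * (1 - 2 * r / 3 - s * s) + 2 * r * s); [| field].
  rewrite Es. field. }
transitivity ((r * (2 * s + 2 - r)) / (3 * r * s * (1 - 2 * r / 3 + s))).
- field. repeat split; lra.
- rewrite E. field. repeat split; lra.
Qed.

Lemma continuous_mean_log (r : R) : 0 <= r <= 1 -> continuous mean_log r.
Proof.
intros Hr. unfold mean_log.
assert (Hs := sqrt_pos ((1 - r) * (1 - r / 3))).
apply (continuous_opp (fun r => ln ((1 - 2 * r / 3 + sqrt ((1 - r) * (1 - r / 3))) / 2))).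
apply continuous_comp with (g := ln).
2: { apply continuity_pt_filterlim, derivable_continuous_pt.
     exists (/ ((1 - 2 * r / 3 + sqrt ((1 - r) * (1 - r / 3))) / 2)).
     apply derivable_pt_lim_ln. lra. }
apply (continuous_mult (fun r => 1 - 2 * r / 3 + sqrt ((1 - r) * (1 - r / 3)))
         (fun _ => / 2)); [| apply continuous_const].
apply (continuous_plus (fun r => 1 - 2 * r / 3) (fun r => sqrt ((1 - r) * (1 - r / 3)))).
- apply (ex_derive_continuous (fun r => 1 - 2 * r / 3)). auto_derive. easy.
- apply continuous_comp with (g := sqrt); [| apply continuous_sqrt].
  apply (ex_derive_continuous (fun r => (1 - r) * (1 - r / 3))). auto_derive. easy.
Qed.

Lemma lt_CV_radius_I (r : R) :
  0 <= r < 1 -> Rbar_lt (Rabs r) (CV_radius (fun n => I_ (S n))).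
Proof.
intros Hr. apply Rbar_lt_le_trans with 1.
- simpl. rewrite Rabs_pos_eq; lra.
- apply (CV_radius_bounded (fun n => I_ (S n))). exists 1. intros n.
  rewrite pow1, Rmult_1_r. assert (H := I_bounds (S n)).
  rewrite Rabs_pos_eq; lra.
Qed.

Lemma PSeries_I (r : R) :
  0 < r < 1 ->
  PSeries (fun n => I_ (S n)) r = (/ sqrt ((1 - r) * (1 - r / 3)) - 1) / r.
Proof.
intros Hr. assert (HPI := PI_RGT_0).
assert (I0 : I_ 0 = 1).
{ unfold I_. rewrite (RInt_ext _ (fun _ => 1)) by easy. rewrite RInt_const.
  unfold scal; simpl; unfold mult; simpl. field. lra. }
assert (HS := is_pseries_I r ltac:(lra)).
assert (HD := PSeries_decr_1 I_ r (ex_intro _ _ HS)).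
rewrite (is_pseries_unique _ _ _ HS), I0 in HD. rewrite HD.
change (PS_decr_1 I_) with (fun n => I_ (S n)). field. lra.
Qed.

(** Both sides vanish at 0 and have the same derivative on (0, 1). The mean value
    theorem asks for derivatives in the open interval only, which avoids the
    removable singularity of (1 / s - 1) / r at r = 0. *)
Lemma PSeries_Int_I (r : R) :
  0 <= r < 1 -> PSeries (PS_Int (fun n => I_ (S n))) r = mean_log r.
Proof.
intros Hr.
set (b := fun n => I_ (S n)).
assert (HR : forall x, 0 <= x < 1 -> Rbar_lt (Rabs x) (CV_radius (PS_Int b))).
{ intros x Hx. rewrite CV_radius_Int. apply lt_CV_radius_I, Hx. }
assert (E0 : PSeries (PS_Int b) 0 - mean_log 0 = 0).
{ rewrite PSeries_0. unfold mean_log.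
  replace ((1 - 0) * (1 - 0 / 3)) with 1 by field. rewrite sqrt_1.
  replace ((1 - 2 * 0 / 3 + 1) / 2) with 1 by field. rewrite ln_1. simpl. ring. }
destruct (MVT_gen (fun x => PSeries (PS_Int b) x - mean_log x) 0 r (fun _ => 0))
  as [c [_ Hc]].
- intros x Hx. rewrite Rmin_left, Rmax_right in Hx by lra.
  replace 0 with (PSeries (PS_derive (PS_Int b)) x
                  - (/ sqrt ((1 - x) * (1 - x / 3)) - 1) / x).
  + apply (is_derive_minus (PSeries (PS_Int b)) mean_log).
    * apply is_derive_PSeries, HR. lra.
    * apply is_derive_mean_log. lra.
  + rewrite <- (PSeries_I x) by lra. apply Rminus_diag_eq, PSeries_ext. intros n.
    unfold PS_derive, PS_Int, b. field. apply not_0_INR. easy.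
- intros x Hx. rewrite Rmin_left, Rmax_right in Hx by lra.
  apply continuity_pt_minus.
  + apply PSeries_continuity, HR. lra.
  + apply continuity_pt_filterlim, continuous_mean_log. lra.
- lra.
Qed.

Theorem theorem5p2 : ex_series M_term /\ M = ln 6.
Proof.
assert (H : is_series (PS_Int (fun n => I_ (S n))) (ln 6)).
{ apply is_series_of_left_limit.
  - intros [|n]; [apply Rle_refl |].
    change (0 <= I_ (S n) / INR (S n)).
    apply Rmult_le_pos; [apply I_bounds |].
    left. apply Rinv_0_lt_compat, lt_0_INR, Nat.lt_0_succ.
  - intros r Hr. apply CV_radius_inside. rewrite CV_radius_Int.
    apply lt_CV_radius_I. lra.
  - apply filterlim_ext_loc with mean_log.
    + generalize at_left_1_unit_interval. apply filter_imp. intros r Hr.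
      symmetry. apply PSeries_Int_I. lra.
    + replace (ln 6) with (mean_log 1).
      2: { unfold mean_log. replace ((1 - 1) * (1 - 1 / 3)) with 0 by field.
           rewrite sqrt_0. replace ((1 - 2 * 1 / 3 + 0) / 2) with (/ 6) by field.
           rewrite ln_Rinv by lra. ring. }
      apply (filterlim_filter_le_1 (F := locally 1) (G := at_left 1)).
      { apply filter_le_within. }
      apply continuous_mean_log. lra. }
assert (HM : is_series M_term (ln 6)).
{ apply (is_series_incr_1 (PS_Int (fun n => I_ (S n)))).
  rewrite <- (plus_zero_r (ln 6)) in H. exact H. }
split; [exists (ln 6); exact HM | exact (is_series_unique _ _ HM)].
Qed.
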